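(* For all integers $n\ge 26$, $$n!\le \sqrt{2\pi n}\left(\frac{n}{e}\right)^n \exp\left(\frac{1}{12n}-\frac{1}{360n^3}+\frac{1}{1260n^5+944n^3}\right).$$
   Context: Here $e$ is the base of the natural logarithm, $\exp(x)=e^x$, and $n!$ is the usual factorial. *)

(* Defs.v *)
From Stdlib Require Export Reals Factorial.

(* Main.v *)
Require Import Defs.
From Stdlib Require Import Reals Factorial.
From Stdlib Require Import Lra Lia.
From Coquelicot Require Import Coquelicot.
Open Scope R_scope.

(** Let mu(n) be the logarithm of n! divided by sqrt(2 pi n) (n/e)^n, and let
    s(x) = 1/(12x) - 1/(360x^3) + 1/(1260x^5) - 1/(1680x^7) + 1/(1188x^9) be
    the Stirling series cut after a positive term. The proof shows mu(n) <= s(n)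
    for every n >= 1, and then compares s with the claimed exponent.

    The difference mu(n) - mu(n+1) is (n + 1/2) ln(1 + 1/n) - 1. With
    u = 1/(2n+1) the logarithm is ln((1+u)/(1-u)), whose power series has only
    odd terms. A lower bound for it makes mu nonincreasing; an upper bound, the
    series with its tail replaced by a geometric one, makes mu - s nondecreasing
    ([log_stirling_error_step_le]). The latter is a rational inequality in n,
    which depends only on p = n(n+1) and becomes a polynomial in p with positive
    coefficients ([stirling_series_diff]).

    So mu converges to some L, and mu(n) - s(n) <= L for all n, as s >= 0.
    Wallis' integrals give 2 mu(n) - mu(2n) <= 1/n, so L = 2L - L <= 0
    ([log_stirling_error_lim]). Hence mu <= s.

    The claimed exponent r replaces the last three terms of s by
    1/(1260x^5 + 944x^3), whose expansion is
    1/(1260x^5) - (944/1260^2)/x^7 + ... Here 944/1260^2 is slightly smaller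
    than 1/1680 = 945/1260^2, so s <= r for large x; x >= 26 suffices
    ([stirling_series_le]). The sequence r - mu itself is not decreasing near
    n = 26, which is why the comparison goes through s. *)

(** * Bounds for ln((1+u)/(1-u)) *)

Lemma nonneg_of_derive_nonneg (f df : R -> R) (b : R) :
  0 <= b -> f 0 = 0 ->
  (forall x, 0 <= x <= b -> is_derive f x (df x)) ->
  (forall x, 0 <= x <= b -> 0 <= df x) ->
  0 <= f b.
Proof.
intros Hb f0 Hd Hp.
destruct (MVT_gen f 0 b df) as [c [Hc E]].
- rewrite Rmin_left, Rmax_right by lra. intros x Hx. apply Hd. lra.
- rewrite Rmin_left, Rmax_right by lra. intros x Hx.
  apply derivable_continuous_pt. exists (df x).
  apply is_derive_Reals, Hd, Hx.
- rewrite Rmin_left, Rmax_right in Hc by lra.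
  specialize (Hp c Hc). nra.
Qed.

Lemma ln_ratio_lower (u : R) : 0 <= u < 1 -> 2 * u <= ln (1 + u) - ln (1 - u).
Proof.
intros Hu.
cut (0 <= ln (1 + u) - ln (1 - u) - 2 * u); [lra|].
apply (nonneg_of_derive_nonneg (fun x => ln (1 + x) - ln (1 - x) - 2 * x)
         (fun x => 2 * x ^ 2 / (1 - x ^ 2))); [lra| | |].
- rewrite Rplus_0_r, Rminus_0_r, ln_1. ring.
- intros x Hx. auto_derive; [repeat split; lra|]. field. split; nra.
- intros x Hx. apply Rmult_le_pos; [nra|].
  left; apply Rinv_0_lt_compat. nra.
Qed.

(** The exact tail u^11/11 + u^13/13 + ... is bounded by (u^11 + u^13 + ...)/11.
    Cutting at u^11 is fine enough for the five-term Stirling series: after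
    division by u the excess is u^12 (1/11 - 1/13) + ..., smaller than the gain
    coming from the next Stirling term. *)
Lemma ln_ratio_upper (u : R) : 0 <= u < 1 ->
  ln (1 + u) - ln (1 - u) <=
  2 * (u + u ^ 3 / 3 + u ^ 5 / 5 + u ^ 7 / 7 + u ^ 9 / 9
       + u ^ 11 / (11 * (1 - u ^ 2))).
Proof.
intros Hu.
cut (0 <= 2 * (u + u ^ 3 / 3 + u ^ 5 / 5 + u ^ 7 / 7 + u ^ 9 / 9
       + u ^ 11 / (11 * (1 - u ^ 2))) - (ln (1 + u) - ln (1 - u))); [lra|].
apply (nonneg_of_derive_nonneg
  (fun x => 2 * (x + x ^ 3 / 3 + x ^ 5 / 5 + x ^ 7 / 7 + x ^ 9 / 9
       + x ^ 11 / (11 * (1 - x ^ 2))) - (ln (1 + x) - ln (1 - x)))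
  (fun x => 4 * x ^ 12 / (11 * (1 - x ^ 2) ^ 2))); [lra| | |].
- rewrite Rplus_0_r, Rminus_0_r, ln_1. field.
- intros x Hx. assert (Hx2 : 0 < 1 - x ^ 2) by nra.
  auto_derive; [repeat split; try lra; simpl in Hx2; nra|].
  field. repeat split; nra.
- intros x Hx. assert (Hx2 : 0 < 1 - x ^ 2) by nra.
  apply Rmult_le_pos.
  + assert (0 <= x ^ 12) by (apply pow_le; lra). lra.
  + left; apply Rinv_0_lt_compat.
    assert (0 < (1 - x ^ 2) ^ 2) by (apply pow_lt; lra). lra.
Qed.

(** * Increments of the error of Stirling's formula *)

Definition stirling_series (x : R) : R :=
  1 / (12 * x) - 1 / (360 * x ^ 3) + 1 / (1260 * x ^ 5)
  - 1 / (1680 * x ^ 7) + 1 / (1188 * x ^ 9).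

(** The logarithm of n! / (sqrt(2 pi n) (n/e)^n), for n >= 1. *)
Definition log_stirling_error (n : nat) : R :=
  ln (INR (fact n))
  - (ln (2 * PI) / 2 + (INR n + / 2) * ln (INR n) - INR n).

(** With u = 1/(2n+1), the quotient (1+u)/(1-u) is (n+1)/n. *)
Lemma log_stirling_error_step (n : nat) : (1 <= n)%nat ->
  log_stirling_error n - log_stirling_error (S n) =
  (INR n + / 2) * (ln (1 + / (2 * INR n + 1)) - ln (1 - / (2 * INR n + 1))) - 1.
Proof.
intros Hn.
assert (Hx : 1 <= INR n) by (apply (le_INR 1); exact Hn).
assert (Hf : 0 < INR (fact n)) by apply INR_fact_lt_0.
unfold log_stirling_error.
rewrite fact_simpl, mult_INR, S_INR, (ln_mult (INR n + 1)) by lra.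
replace (1 + / (2 * INR n + 1)) with ((INR n + 1) * (2 / (2 * INR n + 1)))
  by (field; lra).
replace (1 - / (2 * INR n + 1)) with (INR n * (2 / (2 * INR n + 1)))
  by (field; lra).
assert (0 < 2 / (2 * INR n + 1)) by (apply Rdiv_lt_0_compat; lra).
rewrite (ln_mult (INR n + 1)), (ln_mult (INR n)) by lra.
field.
Qed.

Lemma log_stirling_error_decr (n : nat) : (1 <= n)%nat ->
  log_stirling_error (S n) <= log_stirling_error n.
Proof.
intros Hn.
assert (Hx : 1 <= INR n) by (apply (le_INR 1); exact Hn).
cut (0 <= log_stirling_error n - log_stirling_error (S n)); [lra|].
rewrite log_stirling_error_step by exact Hn.
assert (Hi : (2 * INR n + 1) * / (2 * INR n + 1) = 1) by (field; lra).
assert (Hu : 0 <= / (2 * INR n + 1) < 1).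
{ split; [left; apply Rinv_0_lt_compat; lra|].
  rewrite <- Rinv_1. apply Rinv_lt_contravar; lra. }
generalize (ln_ratio_lower _ Hu). nra.
Qed.

(** For odd k, (x+1)^k - x^k is invariant under x -> -1-x, hence a polynomial in
    p = x(x+1); likewise (2x+1)^2 = 4p+1. Both sides are thus rational functions
    of p alone. The terms of s are such that the coefficients of p^8, ..., p^12
    in the numerator cancel, and the remaining ones are all positive. *)
Lemma stirling_series_diff (x : R) : 0 < x ->
  let p := x * (x + 1) in
  let v := / (4 * p + 1) in
  stirling_series x - stirling_series (x + 1)
  - (v / 3 + v ^ 2 / 5 + v ^ 3 / 7 + v ^ 4 / 9 + v ^ 5 / (11 * (1 - v))) =
  (149657 / 27720 * p ^ 7 + 34081 / 3080 * p ^ 6 + 177959 / 18480 * p ^ 5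
   + 383947 / 83160 * p ^ 4 + 219203 / 166320 * p ^ 3 + 12427 / 55440 * p ^ 2
   + 25 / 1188 * p + 1 / 1188) / (p ^ 9 * (4 * p + 1) ^ 4).
Proof.
intros Hx p v.
assert (Hp : 0 < p) by (unfold p; nra).
assert (E1 : 1 / x - 1 / (x + 1) = 1 / p) by (unfold p; field; lra).
assert (E3 : 1 / x ^ 3 - 1 / (x + 1) ^ 3 = (3 * p + 1) / p ^ 3)
  by (unfold p; field; lra).
assert (E5 : 1 / x ^ 5 - 1 / (x + 1) ^ 5 = (5 * p ^ 2 + 5 * p + 1) / p ^ 5)
  by (unfold p; field; lra).
assert (E7 : 1 / x ^ 7 - 1 / (x + 1) ^ 7 =
             (7 * p ^ 3 + 14 * p ^ 2 + 7 * p + 1) / p ^ 7)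
  by (unfold p; field; lra).
assert (E9 : 1 / x ^ 9 - 1 / (x + 1) ^ 9 =
             (9 * p ^ 4 + 30 * p ^ 3 + 27 * p ^ 2 + 9 * p + 1) / p ^ 9)
  by (unfold p; field; lra).
replace (stirling_series x - stirling_series (x + 1)) with
  ((1 / x - 1 / (x + 1)) / 12 - (1 / x ^ 3 - 1 / (x + 1) ^ 3) / 360
   + (1 / x ^ 5 - 1 / (x + 1) ^ 5) / 1260 - (1 / x ^ 7 - 1 / (x + 1) ^ 7) / 1680
   + (1 / x ^ 9 - 1 / (x + 1) ^ 9) / 1188)
  by (unfold stirling_series; field; lra).
rewrite E1, E3, E5, E7, E9.
(* Forgetting that p is x(x+1) leaves an identity in one variable. *)
unfold v. clearbody p. field. lra.
Qed.

Lemma log_stirling_error_step_le (n : nat) : (1 <= n)%nat ->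
  log_stirling_error n - log_stirling_error (S n) <=
  stirling_series (INR n) - stirling_series (INR (S n)).
Proof.
intros Hn.
assert (Hx : 1 <= INR n) by (apply (le_INR 1); exact Hn).
rewrite log_stirling_error_step, S_INR by exact Hn.
assert (D := stirling_series_diff (INR n) ltac:(lra)). cbv zeta in D.
set (x := INR n) in *.
set (p := x * (x + 1)) in *.
assert (Hp : 0 < p) by (unfold p; nra).
set (u := / (2 * x + 1)).
assert (Hu : 0 <= u < 1).
{ unfold u; split; [left; apply Rinv_0_lt_compat; lra|].
  rewrite <- Rinv_1. apply Rinv_lt_contravar; lra. }
assert (Hxu : x + / 2 = / (2 * u)) by (unfold u; field; lra).
assert (Hu0 : 0 < u) by (unfold u; apply Rinv_0_lt_compat; lra).
assert (Hv : / (4 * p + 1) = u ^ 2) by (unfold u, p; field; nra).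
rewrite Hv in D.
assert (Hpos : 0 <= (149657 / 27720 * p ^ 7 + 34081 / 3080 * p ^ 6
   + 177959 / 18480 * p ^ 5 + 383947 / 83160 * p ^ 4 + 219203 / 166320 * p ^ 3
   + 12427 / 55440 * p ^ 2 + 25 / 1188 * p + 1 / 1188)
   / (p ^ 9 * (4 * p + 1) ^ 4)).
{ assert (H := fun k => pow_lt p k Hp).
  apply Rmult_le_pos.
  - generalize (H 7%nat) (H 6%nat) (H 5%nat) (H 4%nat) (H 3%nat) (H 2%nat). lra.
  - left. apply Rinv_0_lt_compat, Rmult_lt_0_compat; apply pow_lt; lra. }
assert (HL := Rmult_le_compat_l (/ (2 * u)) _ _
  ltac:(left; apply Rinv_0_lt_compat; lra) (ln_ratio_upper u Hu)).
rewrite Hxu.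
replace (/ (2 * u) * (2 * (u + u ^ 3 / 3 + u ^ 5 / 5 + u ^ 7 / 7 + u ^ 9 / 9
       + u ^ 11 / (11 * (1 - u ^ 2))))) with
  (1 + (u ^ 2 / 3 + (u ^ 2) ^ 2 / 5 + (u ^ 2) ^ 3 / 7 + (u ^ 2) ^ 4 / 9
        + (u ^ 2) ^ 5 / (11 * (1 - u ^ 2)))) in HL by (field; split; nra).
lra.
Qed.

(** * Wallis' integrals *)

Definition wallis (n : nat) : R := RInt (fun x => sin x ^ n) 0 (PI / 2).

Lemma is_RInt_sin_pow (n : nat) :
  is_RInt (fun x => sin x ^ n) 0 (PI / 2) (wallis n).
Proof.
apply (RInt_correct (V := R_CompleteNormedModule)).
apply (ex_RInt_continuous (V := R_CompleteNormedModule)).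
intros x _. apply (ex_derive_continuous (fun x => sin x ^ n)).
auto_derive. exact I.
Qed.

(** Integration by parts: the derivative of -cos x sin^(n+1) x is
    (n+2) sin^(n+2) x - (n+1) sin^n x, and the primitive vanishes at both ends. *)
Lemma wallis_SS (n : nat) :
  (INR n + 2) * wallis (S (S n)) = (INR n + 1) * wallis n.
Proof.
set (F := fun x => - (cos x * sin x ^ S n)).
set (G := fun x => (INR n + 2) * sin x ^ S (S n) - (INR n + 1) * sin x ^ n).
assert (H1 : is_RInt G 0 (PI / 2) (F (PI / 2) - F 0)).
{ apply (is_RInt_derive (V := R_CompleteNormedModule) F G).
  - intros x _. unfold F, G. auto_derive; [exact I|].
    (* auto_derive leaves INR (S n) in unfolded form. *)
    replace (match n with O => 1 | S _ => INR n + 1 end) with (INR n + 1)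
      by (destruct n; simpl; ring).
    assert (Hc : cos x * cos x = 1 - sin x * sin x)
      by (generalize (sin2_cos2 x); unfold Rsqr; lra).
    simpl. ring_simplify.
    replace (cos x ^ 2) with (1 - sin x * sin x) by (rewrite <- Hc; ring).
    ring.
  - intros x _. apply (ex_derive_continuous G). unfold G. auto_derive. exact I. }
assert (H2 : is_RInt G 0 (PI / 2)
   ((INR n + 2) * wallis (S (S n)) - (INR n + 1) * wallis n)).
{ apply (is_RInt_minus (V := R_NormedModule)
      (fun x => (INR n + 2) * sin x ^ S (S n)) (fun x => (INR n + 1) * sin x ^ n)).
  - apply (is_RInt_scal (V := R_NormedModule) (fun x => sin x ^ S (S n))).
    apply is_RInt_sin_pow.
  - apply (is_RInt_scal (V := R_NormedModule) (fun x => sin x ^ n)).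
    apply is_RInt_sin_pow. }
assert (E := is_RInt_unique (V := R_CompleteNormedModule) _ _ _ _ H1).
rewrite (is_RInt_unique (V := R_CompleteNormedModule) _ _ _ _ H2) in E.
unfold F in E. rewrite cos_PI2, sin_0, pow_i in E by lia. lra.
Qed.

Lemma wallis_0 : wallis 0 = PI / 2.
Proof.
unfold wallis. simpl.
rewrite RInt_const. unfold scal; simpl; unfold mult; simpl. ring.
Qed.

Lemma wallis_1 : wallis 1 = 1.
Proof.
apply (is_RInt_unique (V := R_CompleteNormedModule)).
replace 1 with (minus (- cos (PI / 2)) (- cos 0))
  by (rewrite cos_PI2, cos_0; unfold minus, plus, opp; simpl; ring).
apply (is_RInt_derive (V := R_CompleteNormedModule) (fun x => - cos x)).
- intros x _. auto_derive; [exact I|]. simpl; ring.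
- intros x _. apply (ex_derive_continuous (fun x => sin x ^ 1)). auto_derive. exact I.
Qed.

Lemma wallis_decr (n : nat) : wallis (S n) <= wallis n.
Proof.
generalize PI_RGT_0; intros HPI.
apply RInt_le; [lra|eexists; apply is_RInt_sin_pow|eexists; apply is_RInt_sin_pow|].
intros x Hx.
assert (0 <= sin x) by (apply sin_ge_0; lra).
assert (0 <= sin x ^ n) by (apply pow_le; lra).
generalize (SIN_bound x). simpl. nra.
Qed.

Lemma wallis_prod (n : nat) : (INR n + 1) * (wallis n * wallis (S n)) = PI / 2.
Proof.
induction n as [|n IH].
- rewrite wallis_0, wallis_1. simpl. lra.
- rewrite S_INR, <- IH. generalize (wallis_SS n). intros E.
  replace ((INR n + 1 + 1) * (wallis (S n) * wallis (S (S n)))) with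
    (wallis (S n) * ((INR n + 2) * wallis (S (S n)))) by ring.
  rewrite E. ring.
Qed.

(** W(2n) = (pi/2) (2n)! / (4^n n!^2): the central binomial coefficient, which
    is what 2 mu(n) - mu(2n) measures. *)
Lemma wallis_even (n : nat) :
  wallis (2 * n) * (4 ^ n * INR (fact n) ^ 2) = PI / 2 * INR (fact (2 * n)).
Proof.
induction n as [|n IH].
- simpl. rewrite wallis_0. ring.
- replace (2 * S n)%nat with (S (S (2 * n))) by lia.
  rewrite !fact_simpl, !mult_INR, !S_INR, mult_INR.
  assert (E := wallis_SS (2 * n)). rewrite mult_INR in E.
  simpl (INR 2) in *. simpl (4 ^ S n).
  replace (wallis (S (S (2 * n))) * (4 * 4 ^ n * ((INR n + 1) * INR (fact n)) ^ 2))
    with (2 * (INR n + 1) * (4 ^ n * INR (fact n) ^ 2)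
          * (((1 + 1) * INR n + 2) * wallis (S (S (2 * n))))) by ring.
  rewrite E.
  replace (2 * (INR n + 1) * (4 ^ n * INR (fact n) ^ 2)
    * (((1 + 1) * INR n + 1) * wallis (2 * n))) with
    (2 * (INR n + 1) * ((1 + 1) * INR n + 1)
     * (wallis (2 * n) * (4 ^ n * INR (fact n) ^ 2))) by ring.
  rewrite IH. ring.
Qed.

Lemma wallis_even_pos (n : nat) : 0 < wallis (2 * n).
Proof.
assert (E := wallis_even n).
assert (H : 0 < 4 ^ n * INR (fact n) ^ 2)
  by (apply Rmult_lt_0_compat; apply pow_lt; [lra|apply INR_fact_lt_0]).
assert (0 < INR (fact (2 * n))) by apply INR_fact_lt_0.
generalize PI_RGT_0; intros HPI.
apply (Rmult_lt_reg_r _ _ _ H). rewrite E. nra.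
Qed.

(** * The constant in Stirling's formula *)

Lemma log_stirling_error_double (n : nat) : (1 <= n)%nat ->
  2 * log_stirling_error n - log_stirling_error (2 * n) =
  - (ln (4 * INR n * wallis (2 * n) ^ 2 / PI) / 2).
Proof.
intros Hn.
assert (Hx : 1 <= INR n) by (apply (le_INR 1); exact Hn).
generalize PI_RGT_0 (wallis_even_pos n) (INR_fact_lt_0 n) (INR_fact_lt_0 (2 * n)).
intros HPI HW Hf Hf2.
assert (E := f_equal ln (wallis_even n)).
assert (H4 : 0 < 4 ^ n) by (apply pow_lt; lra).
assert (Hsq : 0 < INR (fact n) ^ 2) by (apply pow_lt; lra).
assert (Hw2 : 0 < wallis (2 * n) ^ 2) by (apply pow_lt; lra).
assert (L4 : ln 4 = 2 * ln 2) by (replace 4 with (2 * 2) by ring; rewrite ln_mult; lra).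
rewrite (ln_mult (wallis (2 * n))), (ln_mult (4 ^ n)), (ln_mult (PI / 2)),
  (ln_div PI), !ln_pow in E by (try lra; apply Rmult_lt_0_compat; lra).
rewrite (ln_div _ PI), (ln_mult _ (wallis (2 * n) ^ 2)), (ln_mult 4), ln_pow
  by (try lra; apply Rmult_lt_0_compat; lra).
unfold log_stirling_error.
rewrite mult_INR. simpl (INR 2) in *. replace (1 + 1) with 2 in * by ring.
rewrite (ln_mult 2 (INR n)), (ln_mult 2 PI) by lra.
rewrite L4 in *. nra.
Qed.

(** W(2n)^2 >= W(2n) W(2n+1) = pi/(2(2n+1)) gives
    4 n W(2n)^2 / pi >= 1/(1 + 1/(2n)), so the left side is at most
    ln(1 + 1/(2n)) / 2. *)
Lemma log_stirling_error_double_le (n : nat) : (1 <= n)%nat ->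
  2 * log_stirling_error n - log_stirling_error (2 * n) <= / INR n.
Proof.
intros Hn.
rewrite log_stirling_error_double by exact Hn.
assert (Hx : 1 <= INR n) by (apply (le_INR 1); exact Hn).
generalize PI_RGT_0 (wallis_even_pos n); intros HPI HW.
assert (Hprod := wallis_prod (2 * n)).
rewrite mult_INR in Hprod. simpl (INR 2) in Hprod.
assert (Hd := wallis_decr (2 * n)).
set (w := wallis (2 * n)) in *. set (x := INR n) in *.
set (w' := wallis (S (2 * n))) in *.
assert (Hlow : PI / 2 <= (2 * x + 1) * w ^ 2).
{ rewrite <- Hprod. replace (w ^ 2) with (w * w) by ring.
  replace ((1 + 1) * x + 1) with (2 * x + 1) by ring.
  apply Rmult_le_compat_l; [lra|]. apply Rmult_le_compat_l; [lra|exact Hd]. }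
assert (Hr : / (1 + / (2 * x)) <= 4 * x * w ^ 2 / PI).
{ replace (/ (1 + / (2 * x))) with (4 * x * (PI / 2 / (2 * x + 1)) / PI)
    by (field; lra).
  unfold Rdiv. apply Rmult_le_compat_r; [left; apply Rinv_0_lt_compat; lra|].
  apply Rmult_le_compat_l; [lra|].
  apply Rle_div_l; unfold Rdiv in *; lra. }
assert (Hi : 0 < / (2 * x)) by (apply Rinv_0_lt_compat; lra).
assert (Hl : ln (/ (1 + / (2 * x))) <= ln (4 * x * w ^ 2 / PI)).
{ apply ln_le; [apply Rinv_0_lt_compat; lra|exact Hr]. }
rewrite ln_Rinv in Hl by lra.
assert (Hln : ln (1 + / (2 * x)) <= / (2 * x)).
{ rewrite <- (ln_exp (/ (2 * x))) at 2. apply ln_le; [lra|].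
  left. apply exp_ineq1. lra. }
rewrite Rinv_mult in *. assert (0 < / x) by (apply Rinv_0_lt_compat; lra).
lra.
Qed.

Lemma stirling_series_nonneg (x : R) : 1 <= x -> 0 <= stirling_series x.
Proof.
intros Hx.
replace (stirling_series x) with
  ((30 * x ^ 2 - 1) / (360 * x ^ 3) + (4 * x ^ 2 - 3) / (5040 * x ^ 7)
   + 1 / (1188 * x ^ 9)) by (unfold stirling_series; field; lra).
assert (H := fun k => pow_lt x k ltac:(lra)).
generalize (H 3%nat) (H 7%nat) (H 9%nat); intros H3 H7 H9.
repeat apply Rplus_le_le_0_compat; apply Rdiv_le_0_compat; nra.
Qed.

(** The sequence mu is nonincreasing and bounded below by mu(1) - s(1), because
    mu - s is nondecreasing and s >= 0. Passing to the limit in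
    2 mu(n) - mu(2n) <= 1/n along its doubled subsequence gives L <= 0. *)
Lemma log_stirling_error_lim :
  exists L : R, is_lim_seq (fun n => log_stirling_error (S n)) L /\ L <= 0.
Proof.
(* The shift by one avoids n = 0, so 2(n+1) is the index 2n+1 of u. *)
set (u := fun n => log_stirling_error (S n)).
set (b := fun n => u n - stirling_series (INR (S n))).
assert (Hs : forall n, 0 <= stirling_series (INR (S n))).
{ intros n. apply stirling_series_nonneg. rewrite S_INR. generalize (pos_INR n). lra. }
assert (Hb : forall n, b 0%nat <= b n).
{ induction n as [|n IH]; [lra|]. apply (Rle_trans _ _ _ IH).
  generalize (log_stirling_error_step_le (S n) ltac:(lia)). unfold b, u. lra. }
destruct (ex_finite_lim_seq_decr u (b 0%nat)) as [L HL].
{ intros n. apply log_stirling_error_decr. lia. }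
{ intros n. generalize (Hb n) (Hs n). unfold b. lra. }
exists L. split; [exact HL|].
assert (H2 : is_lim_seq (fun n => u (2 * n + 1)%nat) L).
{ apply (is_lim_seq_subseq u L (fun n => (2 * n + 1)%nat)); [|exact HL].
  apply eventually_subseq. intros n. lia. }
assert (Hc : is_lim_seq (fun n => 2 * u n - u (2 * n + 1)%nat) (2 * L - L)).
{ apply is_lim_seq_minus'; [|exact H2].
  apply (is_lim_seq_scal_l u 2 L HL). }
assert (Hi : is_lim_seq (fun n => / INR (S n)) 0).
{ apply (is_lim_seq_incr_1 (fun n => / INR n)).
  apply (is_lim_seq_inv INR p_infty); [apply is_lim_seq_INR|discriminate]. }
assert (H : Rbar_le (2 * L - L) 0); [|simpl in H; lra].
refine (is_lim_seq_le _ _ _ _ _ Hc Hi).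
intros n. unfold u. replace (S (2 * n + 1)) with (2 * S n)%nat by lia.
apply log_stirling_error_double_le. lia.
Qed.

(** The nondecreasing sequence mu - s lies below mu, whose limit is at most 0. *)
Lemma log_stirling_error_le_series (n : nat) : (1 <= n)%nat ->
  log_stirling_error n <= stirling_series (INR n).
Proof.
intros Hn. destruct log_stirling_error_lim as [L [HL L0]].
destruct n as [|n]; [lia|].
set (b := log_stirling_error (S n) - stirling_series (INR (S n))).
assert (Hb : forall k, b <=
  log_stirling_error (S (n + k)) - stirling_series (INR (S (n + k)))).
{ induction k as [|k IH]; [rewrite Nat.add_0_r; apply Rle_refl|].
  replace (n + S k)%nat with (S (n + k)) by lia.
  generalize (log_stirling_error_step_le (S (n + k)) ltac:(lia)). lra. }
assert (H : Rbar_le b L).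
{ apply (is_lim_seq_le (fun _ => b) (fun k => log_stirling_error (S (k + n)))).
  - intros k. rewrite (Nat.add_comm k n).
    assert (0 <= stirling_series (INR (S (n + k)))).
    { apply stirling_series_nonneg. rewrite S_INR. generalize (pos_INR (n + k)). lra. }
    generalize (Hb k). lra.
  - apply is_lim_seq_const.
  - apply (is_lim_seq_incr_n (fun k => log_stirling_error (S k)) n). exact HL. }
simpl in H. unfold b in H. lra.
Qed.

(** * Comparison with the claimed exponent *)

(** With y = x^2, the inequality reduces to y^2/1260 >= (192/385) y + 236/297,
    which holds from about y = 630 on; here y >= 676. *)
Lemma stirling_series_le (x : R) : 26 <= x ->
  stirling_series x <=
  1 / (12 * x) - 1 / (360 * x ^ 3) + 1 / (1260 * x ^ 5 + 944 * x ^ 3).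
Proof.
intros Hx.
assert (Hy : 676 <= x ^ 2) by nra.
assert (H := fun k => pow_lt x k ltac:(lra)).
generalize (H 3%nat) (H 5%nat) (H 9%nat); intros H3 H5 H9.
cut (0 <= 1 / (1260 * x ^ 5 + 944 * x ^ 3)
  - (1 / (1260 * x ^ 5) - 1 / (1680 * x ^ 7) + 1 / (1188 * x ^ 9)));
  [unfold stirling_series; lra|].
replace (1 / (1260 * x ^ 5 + 944 * x ^ 3)
  - (1 / (1260 * x ^ 5) - 1 / (1680 * x ^ 7) + 1 / (1188 * x ^ 9))) with
  ((1 / 1260 * (x ^ 2) ^ 2 - 192 / 385 * x ^ 2 - 236 / 297)
   / (x ^ 9 * (1260 * x ^ 2 + 944))) by (field; repeat split; nra).
apply Rdiv_le_0_compat; [nra|]. apply Rmult_lt_0_compat; lra.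
Qed.

Theorem mainTheorem3 (n : nat) (hn : (26 <= n)%nat) :
  INR (fact n) <=
    sqrt (2 * PI * INR n) * (INR n / exp 1) ^ n *
    exp (1 / (12 * INR n) - 1 / (360 * INR n ^ 3)
         + 1 / (1260 * INR n ^ 5 + 944 * INR n ^ 3)).
Proof.
assert (Hx : 26 <= INR n) by (apply (le_INR 26) in hn; simpl in hn; lra).
generalize PI_RGT_0; intros HPI.
assert (Hq : 0 < INR n / exp 1) by (apply Rdiv_lt_0_compat; [lra|apply exp_pos]).
assert (Hpi : 0 < 2 * PI * INR n) by nra.
assert (Hs : 0 < sqrt (2 * PI * INR n)) by (apply sqrt_lt_R0; exact Hpi).
assert (Hp : 0 < (INR n / exp 1) ^ n) by (apply pow_lt; exact Hq).
assert (Hln : ln (sqrt (2 * PI * INR n) * (INR n / exp 1) ^ n) =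
   ln (2 * PI) / 2 + (INR n + / 2) * ln (INR n) - INR n).
{ rewrite ln_mult, ln_pow, ln_div, ln_exp by (try apply exp_pos; lra).
  rewrite <- Rpower_sqrt by exact Hpi. unfold Rpower. rewrite ln_exp.
  rewrite (ln_mult (2 * PI)) by lra. field. }
assert (E := log_stirling_error_le_series n ltac:(lia)).
assert (E' := stirling_series_le (INR n) Hx).
unfold log_stirling_error in E.
rewrite <- (exp_ln (INR (fact n))) by apply INR_fact_lt_0.
rewrite <- (exp_ln (sqrt (2 * PI * INR n) * (INR n / exp 1) ^ n))
  by (apply Rmult_lt_0_compat; assumption).
rewrite <- exp_plus, Hln. apply Rnot_lt_le. intros H. apply exp_lt_inv in H. lra.
Qed.
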